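(* Let $\mathbb{C}$ and $\mathbb{D}$ be double categories and let $F, G : \mathbb{C} \to \mathbb{D}$ be functors, with associated dummy difunctors $\bar F, \bar G : \mathbb{C}^{\bullet} \times \mathbb{C} \to \mathbb{D}$. The dummy dinatural transformation construction $\alpha \mapsto \ddot{\bar\alpha}$ determines a bijection between natural transformations $F \overset{\bullet}{\to} G$ of functors $\mathbb{C} \to \mathbb{D}$ and dinatural transformations from $\bar F$ to $\bar G$ of difunctors $\mathbb{C}^{\bullet} \times \mathbb{C} \to \mathbb{D}$.
   Context: **Double categories.** A (weak) double category $\mathbb{C}$ has objects, arrows $f : A \to B$, proarrows $m : A \overset{\bullet}{\to} B$, and squares. A square $\varphi$ has a left proarrow $m : A \overset{\bullet}{\to} C$, a right proarrow $n : B \overset{\bullet}{\to} D$, a top arrow $f : A \to B$ and a bottom arrow $g : C \to D$. All composites are written in left-to-right (diagrammatic) order. Arrow-dimension composition, written $\cdot$ with units $\mathrm{id}$, composes arrows, and composes squares horizontally ($\varphi\cdot\psi$ is defined when the right proarrow of $\varphi$ is the left proarrow of $\psi$); it is strictly associative and unital. Proarrow-dimension composition, written $\odot$ with units $\mathrm{U}$, composes proarrows, and composes squares vertically ($\varphi\odot\psi$ is defined when the bottom arrow of $\varphi$ is the top arrow of $\psi$); it is associative and unital only up to coherent isomorphism. A proarrow disk $m \to n$ is a square with left proarrow $m$, right proarrow $n$, and identity top and bottom arrows; it is invertible if it has a two-sided inverse for $\cdot$. Associators and unitors for $\odot$ are suppressed, as are bracketings; an equation that holds after inserting the appropriate coherators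 is written with $\cong$ instead of $=$. Dimensional promotion: a lower-dimensional cell appearing where a higher-dimensional one is expected denotes the corresponding identity (e.g. in $F(A,m)$ with $A$ an object and $m$ a proarrow, $A$ stands for $\mathrm{U}_A$; in $F(g,\varphi)$ with $g$ an arrow and $\varphi$ a square, $g$ stands for $\mathrm{U}_g$; a proarrow in a composite of squares stands for its $\mathrm{id}$). Products of double categories are componentwise. A functor is strict: it preserves boundaries and all composition structure in both dimensions. **Natural transformations.** For functors $F,G:\mathbb{C}\to\mathbb{D}$, a (proarrow-dimension pseudo) natural transformation $\alpha : F \overset{\bullet}{\to} G$ consists of: for each object $A$ a proarrow $\alpha A : FA \overset{\bullet}{\to} GA$; for each arrow $f : A \to B$ a square $\alpha f$ with left $\alpha A$, right $\alpha B$, top $Ff$, bottom $Gf$; for each proarrow $m : A \overset{\bullet}{\to} B$ an invertible proarrow disk $\alpha m : Fm \odot \alpha B \to \alpha A \odot Gm$; such that (i) $\alpha(\mathrm{id}_A)=\mathrm{id}_{\alpha A}$ and $\alpha(f\cdot g)=\alpha f\cdot\alpha g$; (ii) $\alpha(\mathrm{U}_A)\cong \mathrm{id}_{\alpha A}$ and $\alpha(m\odot n)\cong (Fm\odot\alpha n)\cdot(\alpha m\odot Gn)$; (iii) for each square $\varphi$ with left $m$, right $n$, top $f$, bottom $g$: $(F\varphi\odot\alpha g)\cdot\alpha n=\alpha m\cdot(\alpha f\odot G\varphi)$. **Difunctors and dinatural transformations.** $\mathbb{C}^{\bullet}$ denotes the proarrow-dimension reflection of $\mathbb{C}$: it has the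 same objects, arrows, proarrows and squares, but with boundaries in the proarrow dimension transposed (a proarrow $m:A\overset{\bullet}{\to}B$ of $\mathbb{C}$ is a proarrow $B\overset{\bullet}{\to}A$ of $\mathbb{C}^\bullet$, and squares have top and bottom exchanged) and $\odot$-composition order reversed. A difunctor is a functor with domain $\mathbb{C}^{\bullet}\times\mathbb{C}$. For difunctors $F,G:\mathbb{C}^{\bullet}\times\mathbb{C}\to\mathbb{D}$, a (proarrow-dimension pseudo) dinatural transformation $\alpha$ from $F$ to $G$ consists of: for each object $A$ of $\mathbb{C}$ a proarrow $\alpha A:F(A,A)\overset{\bullet}{\to}G(A,A)$; for each arrow $f:A\to B$ of $\mathbb{C}$ a square $\alpha f$ with left $\alpha A$, right $\alpha B$, top $F(f,f)$, bottom $G(f,f)$; for each proarrow $m:A\overset{\bullet}{\to}B$ of $\mathbb{C}$ an invertible proarrow disk $\alpha m:F(B,m)\odot\alpha B\odot G(m,B)\to F(m,A)\odot\alpha A\odot G(A,m)$; such that (i) $\alpha(\mathrm{id}_A)=\mathrm{id}_{\alpha A}$, $\alpha(f\cdot g)=\alpha f\cdot\alpha g$; (ii) $\alpha(\mathrm{U}_A)\cong\mathrm{id}_{\alpha A}$ and, for $m:A\overset{\bullet}{\to}B$, $n:B\overset{\bullet}{\to}C$, $\alpha(m\odot n)\cong(F(C,m)\odot\alpha n\odot G(m,C))\cdot(F(n,A)\odot\alpha m\odot G(A,n))$; (iii) for each square $\varphi$ with left $m$, right $n$, top $f$, bottom $g$: $(F(g,\varphi)\odot\alpha g\odot G(\varphi,g))\cdot\alpha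 n\cong\alpha m\cdot(F(\varphi,f)\odot\alpha f\odot G(f,\varphi))$. **Dummy constructions.** For a functor $F:\mathbb{C}\to\mathbb{D}$, the dummy difunctor $\bar F:\mathbb{C}^{\bullet}\times\mathbb{C}\to\mathbb{D}$ is the second projection $\mathbb{C}^\bullet\times\mathbb{C}\to\mathbb{C}$ followed by $F$. For a natural transformation $\alpha:F\overset{\bullet}{\to}G$ of functors $\mathbb{C}\to\mathbb{D}$, the dummy dinatural transformation $\ddot{\bar\alpha}$ from $\bar F$ to $\bar G$ has components $\ddot{\bar\alpha}A=\alpha A$, $\ddot{\bar\alpha}f=\alpha f$, and, for a proarrow $m$, $\ddot{\bar\alpha}m\cong\alpha m$ (i.e. $\alpha m$ composed with the unitors needed because $\bar F(m,A)=F(\mathrm{U}_A)=\mathrm{U}_{FA}$ and $\bar G(m,B)=\mathrm{U}_{GB}$). *)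

(* Defs.v *)
From Stdlib Require Import Eqdep.
From Stdlib Require Export FinFun.

Set Implicit Arguments.
Unset Strict Implicit.
Unset Printing Implicit Defensive.

Declare Scope dbl_scope.
Delimit Scope dbl_scope with dbl.
Local Open Scope dbl_scope.

Reserved Notation "f · g" (at level 40, left associativity).
Reserved Notation "m ⊙ n" (at level 40, left associativity).
Reserved Notation "φ ·s ψ" (at level 40, left associativity).
Reserved Notation "φ ·d ψ" (at level 40, left associativity).
Reserved Notation "φ ⊙s ψ" (at level 40, left associativity).
Reserved Notation "φ ≡ ψ" (at level 70, no associativity).

(** * Weak double categories *)

(** All compositions are in diagrammatic order.  [Sq f g m n] is the type of
    squares with top arrow [f], bottom arrow [g], left proarrow [m] and right
    proarrow [n]. *)
Record DoubleData := {
  Ob : Type;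
  Arr : Ob -> Ob -> Type;
  Pro : Ob -> Ob -> Type;
  Sq : forall A B C D : Ob, Arr A B -> Arr C D -> Pro A C -> Pro B D -> Type;

  aid : forall A, Arr A A;
  acomp : forall A B C, Arr A B -> Arr B C -> Arr A C;
  sid : forall A B (m : Pro A B), Sq (aid A) (aid B) m m;
  scomp : forall A B C A' B' C' (f : Arr A B) (g : Arr A' B')
      (h : Arr B C) (k : Arr B' C') (m : Pro A A') (n : Pro B B') (p : Pro C C'),
      Sq f g m n -> Sq h k n p -> Sq (acomp f h) (acomp g k) m p;

  U : forall A, Pro A A;
  pcomp : forall A B C, Pro A B -> Pro B C -> Pro A C;
  Us : forall A B (f : Arr A B), Sq f f (U A) (U B);
  scompp : forall A B C A' B' C' (f : Arr A A') (g : Arr B B') (h : Arr C C')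
      (m : Pro A B) (m' : Pro A' B') (n : Pro B C) (n' : Pro B' C'),
      Sq f g m m' -> Sq g h n n' -> Sq f h (pcomp m n) (pcomp m' n');

  assoc : forall A B C D (m : Pro A B) (n : Pro B C) (p : Pro C D),
      Sq (aid A) (aid D) (pcomp (pcomp m n) p) (pcomp m (pcomp n p));
  associ : forall A B C D (m : Pro A B) (n : Pro B C) (p : Pro C D),
      Sq (aid A) (aid D) (pcomp m (pcomp n p)) (pcomp (pcomp m n) p);
  lunit : forall A B (m : Pro A B), Sq (aid A) (aid B) (pcomp (U A) m) m;
  luniti : forall A B (m : Pro A B), Sq (aid A) (aid B) m (pcomp (U A) m);
  runit : forall A B (m : Pro A B), Sq (aid A) (aid B) (pcomp m (U B)) m;
  runiti : forall A B (m : Pro A B), Sq (aid A) (aid B) m (pcomp m (U B))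
}.

Arguments Arr {d} A B.
Arguments Pro {d} A B.
Arguments Sq {d A B C D} f g m n.
Arguments aid {d} A.
Arguments sid {d A B} m.
Arguments U {d} A.
Arguments Us {d A B} f.
Arguments assoc {d A B C D} m n p.
Arguments associ {d A B C D} m n p.
Arguments lunit {d A B} m.
Arguments luniti {d A B} m.
Arguments runit {d A B} m.
Arguments runiti {d A B} m.

Notation "f · g" := (acomp f g) : dbl_scope.
Notation "m ⊙ n" := (pcomp m n) : dbl_scope.
Notation "φ ·s ψ" := (scomp φ ψ) : dbl_scope.
Notation "φ ⊙s ψ" := (scompp φ ψ) : dbl_scope.

(** Equality of squares whose boundaries agree only propositionally (for
    instance [f · aid B] against [f]). *)
Inductive sq_eq (C : DoubleData) (X Y Z W : Ob C) (f : Arr X Y) (g : Arr Z W)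
    (m : Pro X Z) (n : Pro Y W) (φ : Sq f g m n) :
    forall (f' : Arr X Y) (g' : Arr Z W) (m' : Pro X Z) (n' : Pro Y W),
      Sq f' g' m' n' -> Prop :=
  sq_refl : sq_eq φ φ.

Notation "φ ≡ ψ" := (sq_eq φ ψ) : dbl_scope.

Record is_double_category (C : DoubleData) : Prop := {
  aidl : forall (A B : Ob C) (f : Arr A B), aid A · f = f;
  aidr : forall (A B : Ob C) (f : Arr A B), f · aid B = f;
  aassoc : forall (X Y Z W : Ob C) (f : Arr X Y) (g : Arr Y Z) (h : Arr Z W),
      (f · g) · h = f · (g · h);
  sidl : forall (X Y Z W : Ob C) (f : Arr X Y) (g : Arr Z W) (m : Pro X Z)
      (n : Pro Y W) (φ : Sq f g m n), sid m ·s φ ≡ φ;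
  sidr : forall (X Y Z W : Ob C) (f : Arr X Y) (g : Arr Z W) (m : Pro X Z)
      (n : Pro Y W) (φ : Sq f g m n), φ ·s sid n ≡ φ;
  sassoc : forall (X1 X2 X3 X4 Y1 Y2 Y3 Y4 : Ob C)
      (f1 : Arr X1 X2) (f2 : Arr X2 X3) (f3 : Arr X3 X4)
      (g1 : Arr Y1 Y2) (g2 : Arr Y2 Y3) (g3 : Arr Y3 Y4)
      (m1 : Pro X1 Y1) (m2 : Pro X2 Y2) (m3 : Pro X3 Y3) (m4 : Pro X4 Y4)
      (φ : Sq f1 g1 m1 m2) (ψ : Sq f2 g2 m2 m3) (χ : Sq f3 g3 m3 m4),
      (φ ·s ψ) ·s χ ≡ φ ·s (ψ ·s χ);

  Us_id : forall A : Ob C, Us (aid A) = sid (U A);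
  Us_comp : forall (X Y Z : Ob C) (f : Arr X Y) (g : Arr Y Z),
      Us (f · g) = Us f ·s Us g;
  sid_pcomp : forall (X Y Z : Ob C) (m : Pro X Y) (n : Pro Y Z),
      sid (m ⊙ n) = sid m ⊙s sid n;
  interchange : forall (X1 X2 X3 Y1 Y2 Y3 Z1 Z2 Z3 : Ob C)
      (f1 : Arr X1 X2) (f2 : Arr X2 X3) (g1 : Arr Y1 Y2) (g2 : Arr Y2 Y3)
      (h1 : Arr Z1 Z2) (h2 : Arr Z2 Z3)
      (m1 : Pro X1 Y1) (m2 : Pro X2 Y2) (m3 : Pro X3 Y3)
      (n1 : Pro Y1 Z1) (n2 : Pro Y2 Z2) (n3 : Pro Y3 Z3)
      (φ1 : Sq f1 g1 m1 m2) (φ2 : Sq f2 g2 m2 m3)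
      (ψ1 : Sq g1 h1 n1 n2) (ψ2 : Sq g2 h2 n2 n3),
      (φ1 ·s φ2) ⊙s (ψ1 ·s ψ2) = (φ1 ⊙s ψ1) ·s (φ2 ⊙s ψ2);

  associK : forall (X Y Z W : Ob C) (m : Pro X Y) (n : Pro Y Z) (p : Pro Z W),
      assoc m n p ·s associ m n p ≡ sid ((m ⊙ n) ⊙ p);
  assocK : forall (X Y Z W : Ob C) (m : Pro X Y) (n : Pro Y Z) (p : Pro Z W),
      associ m n p ·s assoc m n p ≡ sid (m ⊙ (n ⊙ p));
  lunitiK : forall (X Y : Ob C) (m : Pro X Y), lunit m ·s luniti m ≡ sid (U X ⊙ m);
  lunitK : forall (X Y : Ob C) (m : Pro X Y), luniti m ·s lunit m ≡ sid m;
  runitiK : forall (X Y : Ob C) (m : Pro X Y), runit m ·s runiti m ≡ sid (m ⊙ U Y);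
  runitK : forall (X Y : Ob C) (m : Pro X Y), runiti m ·s runit m ≡ sid m;

  assoc_nat : forall (X X' Y Y' Z Z' W W' : Ob C)
      (f : Arr X X') (g : Arr Y Y') (h : Arr Z Z') (k : Arr W W')
      (m : Pro X Y) (m' : Pro X' Y') (n : Pro Y Z) (n' : Pro Y' Z')
      (p : Pro Z W) (p' : Pro Z' W')
      (φ : Sq f g m m') (ψ : Sq g h n n') (χ : Sq h k p p'),
      ((φ ⊙s ψ) ⊙s χ) ·s assoc m' n' p' ≡ assoc m n p ·s (φ ⊙s (ψ ⊙s χ));
  lunit_nat : forall (X Y Z W : Ob C) (f : Arr X Y) (g : Arr Z W) (m : Pro X Z)
      (n : Pro Y W) (φ : Sq f g m n), (Us f ⊙s φ) ·s lunit n ≡ lunit m ·s φ;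
  runit_nat : forall (X Y Z W : Ob C) (f : Arr X Y) (g : Arr Z W) (m : Pro X Z)
      (n : Pro Y W) (φ : Sq f g m n), (φ ⊙s Us g) ·s runit n ≡ runit m ·s φ;

  pentagon : forall (X Y Z W V : Ob C) (m : Pro X Y) (n : Pro Y Z) (p : Pro Z W)
      (q : Pro W V),
      assoc (m ⊙ n) p q ·s assoc m n (p ⊙ q)
      ≡ ((assoc m n p ⊙s sid q) ·s assoc m (n ⊙ p) q) ·s (sid m ⊙s assoc n p q);
  triangle : forall (X Y Z : Ob C) (m : Pro X Y) (n : Pro Y Z),
      assoc m (U Y) n ·s (sid m ⊙s lunit n) ≡ runit m ⊙s sid n
}.

Record DoubleCategory := {
  dc_data :> DoubleData;
  dc_laws : is_double_category dc_data
}.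

(** * Proarrow disks *)

Notation Disk m n := (Sq (aid _) (aid _) m n).

Definition retype (C : DoubleData) (X Y Z W : Ob C) (f f' : Arr X Y)
    (g g' : Arr Z W) (m : Pro X Z) (n : Pro Y W)
    (ef : f = f') (eg : g = g') (φ : Sq f g m n) : Sq f' g' m n :=
  match ef in _ = f1, eg in _ = g1 return Sq f1 g1 m n with
  | eq_refl, eq_refl => φ
  end.

(** Composition of disks, with [aid X · aid X] identified with [aid X]. *)
Definition dcomp (C : DoubleCategory) (X Y : Ob C) (m n p : Pro X Y)
    (φ : Disk m n) (ψ : Disk n p) : Disk m p :=
  retype (aidl (dc_laws C) (aid X)) (aidl (dc_laws C) (aid Y)) (φ ·s ψ).

Notation "φ ·d ψ" := (dcomp φ ψ) : dbl_scope.

Definition invertible (C : DoubleCategory) (X Y : Ob C) (m n : Pro X Y)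
    (φ : Disk m n) : Prop :=
  exists ψ : Disk n m, φ ·d ψ = sid m /\ ψ ·d φ = sid n.

(** The identity disk between equal proarrows. *)
Definition eqd (C : DoubleData) (X Y : Ob C) (m n : Pro X Y) (e : m = n) :
    Disk m n :=
  match e with eq_refl => sid m end.

Section DiskFacts.
Variable C : DoubleCategory.
Let L := dc_laws C.

Lemma sq_eq_retype (X Y Z W : Ob C) (f f' : Arr X Y) (g g' : Arr Z W)
    (m m' : Pro X Z) (n n' : Pro Y W) (φ : Sq f g m n) (ψ : Sq f' g' m' n') :
  φ ≡ ψ -> forall (ef : f = f') (eg : g = g') (em : m = m') (en : n = n'),
  match em in _ = m1, en in _ = n1 return Sq f' g' m1 n1 with
  | eq_refl, eq_refl => retype ef eg φ
  end = ψ.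
Proof.
intros [] ef eg em en.
now rewrite (UIP_refl _ _ ef), (UIP_refl _ _ eg), (UIP_refl _ _ em), (UIP_refl _ _ en).
Qed.

Lemma sq_eqE (X Y Z W : Ob C) (f : Arr X Y) (g : Arr Z W)
    (m : Pro X Z) (n : Pro Y W) (φ ψ : Sq f g m n) : φ ≡ ψ -> φ = ψ.
Proof. intros H. exact (sq_eq_retype H eq_refl eq_refl eq_refl eq_refl). Qed.

Lemma sq_sym (X Y Z W : Ob C) (f f' : Arr X Y) (g g' : Arr Z W)
    (m m' : Pro X Z) (n n' : Pro Y W) (φ : Sq f g m n) (ψ : Sq f' g' m' n') :
  φ ≡ ψ -> ψ ≡ φ.
Proof. now intros []. Qed.

Lemma sq_trans (X Y Z W : Ob C) (f f' f'' : Arr X Y) (g g' g'' : Arr Z W)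
    (m m' m'' : Pro X Z) (n n' n'' : Pro Y W)
    (φ : Sq f g m n) (ψ : Sq f' g' m' n') (χ : Sq f'' g'' m'' n'') :
  φ ≡ ψ -> ψ ≡ χ -> φ ≡ χ.
Proof. now intros [] []. Qed.

Lemma retype_eq (X Y Z W : Ob C) (f f' : Arr X Y) (g g' : Arr Z W)
    (m : Pro X Z) (n : Pro Y W) (ef : f = f') (eg : g = g') (φ : Sq f g m n) :
  retype ef eg φ ≡ φ.
Proof. now destruct ef, eg. Qed.

Lemma scomp_eq (X1 X2 X3 Y1 Y2 Y3 : Ob C)
    (f f' : Arr X1 X2) (g g' : Arr X2 X3) (h h' : Arr Y1 Y2) (k k' : Arr Y2 Y3)
    (m m' : Pro X1 Y1) (n n' : Pro X2 Y2) (p p' : Pro X3 Y3)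
    (φ : Sq f h m n) (φ' : Sq f' h' m' n') (ψ : Sq g k n p) (ψ' : Sq g' k' n' p') :
  φ ≡ φ' -> ψ ≡ ψ' -> φ ·s ψ ≡ φ' ·s ψ'.
Proof.
intros E; revert g' k' p' ψ'; destruct E; intros g' k' p' ψ' H.
assert (G : g = g') by now destruct H.
assert (K : k = k') by now destruct H.
assert (P : p = p') by now destruct H.
subst. now rewrite (sq_eqE H).
Qed.

Lemma scompp_eq (X1 X2 Y1 Y2 Z1 Z2 : Ob C)
    (f f' : Arr X1 X2) (g g' : Arr Y1 Y2) (h h' : Arr Z1 Z2)
    (m m' : Pro X1 Y1) (n n' : Pro X2 Y2) (p p' : Pro Y1 Z1) (q q' : Pro Y2 Z2)
    (φ : Sq f g m n) (φ' : Sq f' g' m' n') (ψ : Sq g h p q) (ψ' : Sq g' h' p' q') :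
  φ ≡ φ' -> ψ ≡ ψ' -> φ ⊙s ψ ≡ φ' ⊙s ψ'.
Proof.
intros E; revert h' p' q' ψ'; destruct E; intros h' p' q' ψ' H.
assert (G : h = h') by now destruct H.
assert (K : p = p') by now destruct H.
assert (P : q = q') by now destruct H.
subst. now rewrite (sq_eqE H).
Qed.

(** Inverses of equal composites of disks are equal. *)
Lemma sq_inv_unique (X Y : Ob C) (m n : Pro X Y)
    (fa fb fc fd : Arr X X) (ga gb gc gd : Arr Y Y)
    (φ : Sq fa ga m n) (φ' : Sq fb gb m n) (ψ : Sq fc gc n m) (ψ' : Sq fd gd n m) :
  φ ≡ φ' -> ψ ·s φ ≡ sid n -> φ' ·s ψ' ≡ sid m -> ψ ≡ ψ'.
Proof.
intros E H H'.
apply sq_trans with (1 := sq_sym (sidr L ψ)).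
apply sq_trans with (1 := scomp_eq (sq_refl ψ) (sq_sym H')).
apply sq_trans with (1 := sq_sym (sassoc L ψ φ' ψ')).
apply sq_trans with (1 := scomp_eq (scomp_eq (sq_refl ψ) (sq_sym E)) (sq_refl ψ')).
apply sq_trans with (1 := scomp_eq H (sq_refl ψ')).
apply sidl; exact L.
Qed.

Lemma scomp_inv (X Y : Ob C) (m n p : Pro X Y)
    (fa fb fc fd : Arr X X) (ga gb gc gd : Arr Y Y)
    (φ : Sq fa ga m n) (φ' : Sq fb gb n m) (ψ : Sq fc gc n p) (ψ' : Sq fd gd p n) :
  φ ·s φ' ≡ sid m -> ψ ·s ψ' ≡ sid n -> (φ ·s ψ) ·s (ψ' ·s φ') ≡ sid m.
Proof.
intros H H'.
apply sq_trans with (1 := sassoc L φ ψ (ψ' ·s φ')).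
apply sq_trans with (2 := H).
apply scomp_eq; [apply sq_refl|].
apply sq_trans with (1 := sq_sym (sassoc L ψ ψ' φ')).
apply sq_trans with (1 := scomp_eq H' (sq_refl φ')).
apply sidl; exact L.
Qed.

Lemma scompp_inv (X Y Z : Ob C) (m n : Pro X Y) (p q : Pro Y Z)
    (φ : Disk m n) (φ' : Disk n m) (ψ : Disk p q) (ψ' : Disk q p) :
  φ ·s φ' ≡ sid m -> ψ ·s ψ' ≡ sid p ->
  (φ ⊙s ψ) ·s (φ' ⊙s ψ') ≡ sid (m ⊙ p).
Proof.
intros H H'. rewrite <- (interchange L), (sid_pcomp L). now apply scompp_eq.
Qed.

End DiskFacts.

(** * The proarrow-dimension reflection *)

Definition refl_data (C : DoubleData) : DoubleData := {|
  Ob := Ob C;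
  Arr := fun A B => Arr A B;
  Pro := fun A B => Pro B A;
  Sq := fun _ _ _ _ f g m n => Sq g f m n;
  aid := fun A => aid A;
  acomp := fun _ _ _ f g => f · g;
  sid := fun _ _ m => sid m;
  scomp := fun _ _ _ _ _ _ _ _ _ _ _ _ _ φ ψ => φ ·s ψ;
  U := fun A => U A;
  pcomp := fun _ _ _ m n => n ⊙ m;
  Us := fun _ _ f => Us f;
  scompp := fun _ _ _ _ _ _ _ _ _ _ _ _ _ φ ψ => ψ ⊙s φ;
  assoc := fun _ _ _ _ m n p => associ p n m;
  associ := fun _ _ _ _ m n p => assoc p n m;
  lunit := fun _ _ m => runit m;
  luniti := fun _ _ m => runiti m;
  runit := fun _ _ m => lunit m;
  runiti := fun _ _ m => luniti m
|}.

Lemma refl_sq_eq (C : DoubleData) (X Y Z W : Ob C) (f f' : Arr X Y) (g g' : Arr Z W)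
    (m m' : Pro X Z) (n n' : Pro Y W) (φ : Sq f g m n) (ψ : Sq f' g' m' n') :
  φ ≡ ψ -> @sq_eq (refl_data C) Z W X Y g f m n φ g' f' m' n' ψ.
Proof. now intros []. Qed.

Lemma refl_laws (C : DoubleCategory) : is_double_category (refl_data C).
Proof.
pose proof (dc_laws C) as L.
constructor; cbn; intros;
  try (first [ apply (aidl L) | apply (aidr L) | apply (aassoc L)
             | apply (Us_id L) | apply (Us_comp L) | apply (sid_pcomp L)
             | apply (interchange L) ]);
  apply refl_sq_eq;
  try (first [ apply (sidl L) | apply (sidr L) | apply (sassoc L)
             | apply (associK L) | apply (assocK L)
             | apply (lunitK L) | apply (lunitiK L)
             | apply (runitK L) | apply (runitiK L)
             | apply (lunit_nat L) | apply (runit_nat L) ]).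
- (* assoc_nat *)
  apply sq_trans with (1 := sq_sym (sidl L _)).
  apply sq_trans with (1 := scomp_eq (sq_sym (assocK L p n m)) (sq_refl _)).
  apply sq_trans with (1 := sassoc L _ _ _).
  apply scomp_eq; [apply sq_refl|].
  apply sq_trans with (1 := sq_sym (sassoc L _ _ _)).
  apply sq_trans with (1 := scomp_eq (sq_sym (assoc_nat L χ ψ φ)) (sq_refl _)).
  apply sq_trans with (1 := sassoc L _ _ _).
  apply sq_trans with (1 := scomp_eq (sq_refl _) (associK L _ _ _)).
  apply (sidr L).
- (* pentagon *)
  eapply sq_inv_unique; [exact (pentagon L q p n m)| |].
  + apply scomp_inv; apply (assocK L).
  + eapply sq_trans; [|apply scomp_inv].
    * apply scomp_eq; [apply sq_refl|]. apply (sassoc L).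
    * apply scomp_inv; [|apply (associK L)].
      apply scompp_inv; [apply (associK L)|apply (sidl L)].
    * apply scompp_inv; [apply (sidl L)|apply (associK L)].
- (* triangle *)
  apply sq_trans with (1 := scomp_eq (sq_refl _) (sq_sym (triangle L n m))).
  apply sq_trans with (1 := sq_sym (sassoc L _ _ _)).
  apply sq_trans with (1 := scomp_eq (assocK L _ _ _) (sq_refl _)).
  apply (sidl L).
Qed.

Definition refl (C : DoubleCategory) : DoubleCategory :=
  {| dc_data := refl_data C; dc_laws := refl_laws C |}.

(** * Products *)

Definition prod_data (C D : DoubleData) : DoubleData := {|
  Ob := (Ob C * Ob D)%type;
  Arr := fun A B => (Arr (fst A) (fst B) * Arr (snd A) (snd B))%type;
  Pro := fun A B => (Pro (fst A) (fst B) * Pro (snd A) (snd B))%type;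
  Sq := fun _ _ _ _ f g m n =>
    (Sq (fst f) (fst g) (fst m) (fst n) * Sq (snd f) (snd g) (snd m) (snd n))%type;
  aid := fun A => (aid (fst A), aid (snd A));
  acomp := fun _ _ _ f g => (fst f · fst g, snd f · snd g);
  sid := fun _ _ m => (sid (fst m), sid (snd m));
  scomp := fun _ _ _ _ _ _ _ _ _ _ _ _ _ φ ψ => (fst φ ·s fst ψ, snd φ ·s snd ψ);
  U := fun A => (U (fst A), U (snd A));
  pcomp := fun _ _ _ m n => (fst m ⊙ fst n, snd m ⊙ snd n);
  Us := fun _ _ f => (Us (fst f), Us (snd f));
  scompp := fun _ _ _ _ _ _ _ _ _ _ _ _ _ φ ψ => (fst φ ⊙s fst ψ, snd φ ⊙s snd ψ);
  assoc := fun _ _ _ _ m n p =>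
    (assoc (fst m) (fst n) (fst p), assoc (snd m) (snd n) (snd p));
  associ := fun _ _ _ _ m n p =>
    (associ (fst m) (fst n) (fst p), associ (snd m) (snd n) (snd p));
  lunit := fun _ _ m => (lunit (fst m), lunit (snd m));
  luniti := fun _ _ m => (luniti (fst m), luniti (snd m));
  runit := fun _ _ m => (runit (fst m), runit (snd m));
  runiti := fun _ _ m => (runiti (fst m), runiti (snd m))
|}.

Lemma prod_sq_eq (C D : DoubleData) (X Y Z W : Ob (prod_data C D))
    (f f' : Arr X Y) (g g' : Arr Z W) (m m' : Pro X Z) (n n' : Pro Y W)
    (φ : Sq f g m n) (ψ : Sq f' g' m' n') :
  fst φ ≡ fst ψ -> snd φ ≡ snd ψ -> φ ≡ ψ.
Proof.
destruct f, f', g, g', m, m', n, n', φ, ψ; cbn in *.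
now intros [] [].
Qed.

Lemma prod_laws (C D : DoubleCategory) : is_double_category (prod_data C D).
Proof.
pose proof (dc_laws C) as L. pose proof (dc_laws D) as M.
constructor; intros;
  try (apply prod_sq_eq; cbn;
       first [ apply sidl | apply sidr | apply sassoc
             | apply associK | apply assocK | apply lunitiK | apply lunitK
             | apply runitiK | apply runitK | apply assoc_nat
             | apply lunit_nat | apply runit_nat | apply pentagon
             | apply triangle ]; assumption);
  repeat match goal with x : Arr _ _ |- _ => destruct x end;
  cbn; f_equal;
  first [ apply aidl | apply aidr | apply aassoc | apply Us_id
        | apply Us_comp | apply sid_pcomp | apply interchange ]; assumption.
Qed.

Definition dprod (C D : DoubleCategory) : DoubleCategory :=
  {| dc_data := prod_data C D; dc_laws := prod_laws C D |}.

(** * Strict functors *)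

Record Functor (C D : DoubleCategory) := {
  Fo :> Ob C -> Ob D;
  Fa : forall A B, @Arr C A B -> Arr (Fo A) (Fo B);
  Fp : forall A B, @Pro C A B -> Pro (Fo A) (Fo B);
  Fs : forall (X Y Z W : Ob C) (f : Arr X Y) (g : Arr Z W) (m : Pro X Z) (n : Pro Y W),
      Sq f g m n -> Sq (Fa f) (Fa g) (Fp m) (Fp n);

  Fa_id : forall A, Fa (aid A) = aid (Fo A);
  Fa_comp : forall (X Y Z : Ob C) (f : Arr X Y) (g : Arr Y Z), Fa (f · g) = Fa f · Fa g;
  Fs_id : forall (X Y : Ob C) (m : Pro X Y), Fs (sid m) ≡ sid (Fp m);
  Fs_comp : forall (X Y Z X' Y' Z' : Ob C) (f : Arr X Y) (g : Arr X' Y')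
      (h : Arr Y Z) (k : Arr Y' Z') (m : Pro X X') (n : Pro Y Y') (p : Pro Z Z')
      (φ : Sq f g m n) (ψ : Sq h k n p), Fs (φ ·s ψ) ≡ Fs φ ·s Fs ψ;

  Fp_U : forall A, Fp (U A) = U (Fo A);
  Fp_comp : forall (X Y Z : Ob C) (m : Pro X Y) (n : Pro Y Z), Fp (m ⊙ n) = Fp m ⊙ Fp n;
  Fs_Us : forall (X Y : Ob C) (f : Arr X Y), Fs (Us f) ≡ Us (Fa f);
  Fs_compp : forall (X Y Z X' Y' Z' : Ob C) (f : Arr X X') (g : Arr Y Y') (h : Arr Z Z')
      (m : Pro X Y) (m' : Pro X' Y') (n : Pro Y Z) (n' : Pro Y' Z')
      (φ : Sq f g m m') (ψ : Sq g h n n'), Fs (φ ⊙s ψ) ≡ Fs φ ⊙s Fs ψ;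

  Fs_assoc : forall (X Y Z W : Ob C) (m : Pro X Y) (n : Pro Y Z) (p : Pro Z W),
      Fs (assoc m n p) ≡ assoc (Fp m) (Fp n) (Fp p);
  Fs_lunit : forall (X Y : Ob C) (m : Pro X Y), Fs (lunit m) ≡ lunit (Fp m);
  Fs_runit : forall (X Y : Ob C) (m : Pro X Y), Fs (runit m) ≡ runit (Fp m)
}.

Arguments Fa {C D} _ {A B} _.
Arguments Fp {C D} _ {A B} _.
Arguments Fs {C D} _ {X Y Z W f g m n} _.

Lemma Fs_eq (C D : DoubleCategory) (F : Functor C D) (X Y Z W : Ob C)
    (f f' : Arr X Y) (g g' : Arr Z W) (m m' : Pro X Z) (n n' : Pro Y W)
    (φ : Sq f g m n) (ψ : Sq f' g' m' n') :
  φ ≡ ψ -> Fs F φ ≡ Fs F ψ.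
Proof. now intros []. Qed.

Definition fcomp (C D E : DoubleCategory) (F : Functor C D) (G : Functor D E) :
  Functor C E.
Proof.
refine {| Fo := fun A => G (F A);
          Fa := fun _ _ f => Fa G (Fa F f);
          Fp := fun _ _ m => Fp G (Fp F m);
          Fs := fun _ _ _ _ _ _ _ _ φ => Fs G (Fs F φ) |};
  abstract (intros;
    first [ rewrite Fa_id; apply Fa_id
          | rewrite Fa_comp; apply Fa_comp
          | rewrite Fp_U; apply Fp_U
          | rewrite Fp_comp; apply Fp_comp
          | apply (sq_trans (Fs_eq G (Fs_id F _))); apply Fs_id
          | apply (sq_trans (Fs_eq G (Fs_comp F _ _))); apply Fs_comp
          | apply (sq_trans (Fs_eq G (Fs_Us F _))); apply Fs_Us
          | apply (sq_trans (Fs_eq G (Fs_compp F _ _))); apply Fs_compp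
          | apply (sq_trans (Fs_eq G (Fs_assoc F _ _ _))); apply Fs_assoc
          | apply (sq_trans (Fs_eq G (Fs_lunit F _))); apply Fs_lunit
          | apply (sq_trans (Fs_eq G (Fs_runit F _))); apply Fs_runit ]).
Defined.

Definition fsnd (C D : DoubleCategory) : Functor (dprod C D) D.
Proof.
refine {| Fo := fun A : Ob (dprod C D) => snd A;
          Fa := fun _ _ f => snd f;
          Fp := fun _ _ m => snd m;
          Fs := fun _ _ _ _ _ _ _ _ φ => snd φ |};
  abstract (intros; reflexivity || apply sq_refl).
Defined.

(** The image of a disk, with [Fa F (aid X)] identified with [aid (F X)]. *)
Definition Fd (C D : DoubleCategory) (F : Functor C D) (X Y : Ob C)
    (m n : Pro X Y) (φ : Disk m n) : Disk (Fp F m) (Fp F n) :=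
  retype (Fa_id F X) (Fa_id F Y) (Fs F φ).

(** * Natural transformations *)

Section Natural.
Variables (C D : DoubleCategory) (F G : Functor C D).

Record NatData := {
  natO : forall A : Ob C, Pro (F A) (G A);
  natA : forall (A B : Ob C) (f : Arr A B), Sq (Fa F f) (Fa G f) (natO A) (natO B);
  natP : forall (A B : Ob C) (m : Pro A B), Disk (Fp F m ⊙ natO B) (natO A ⊙ Fp G m)
}.

(** In [natP_U] and [natP_comp] both sides are completed by unitors, associators
    and, since [F] and [G] preserve [U] and [⊙] only up to propositional
    equality, by identity disks [eqd]. *)
Record is_natural (α : NatData) : Prop := {
  natP_inv : forall (A B : Ob C) (m : Pro A B), invertible (natP α m);
  natA_id : forall A : Ob C, natA α (aid A) ≡ sid (natO α A);
  natA_comp : forall (A B E : Ob C) (f : Arr A B) (g : Arr B E),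
      natA α (f · g) ≡ natA α f ·s natA α g;
  natP_U : forall A : Ob C,
      natP α (U A) ·d ((sid (natO α A) ⊙s eqd (Fp_U G A)) ·d runit (natO α A))
      = ((eqd (Fp_U F A) ⊙s sid (natO α A)) ·d lunit (natO α A)) ·d sid (natO α A);
  natP_comp : forall (A B E : Ob C) (m : Pro A B) (n : Pro B E),
      natP α (m ⊙ n) ·d (sid (natO α A) ⊙s eqd (Fp_comp G m n))
      = (eqd (Fp_comp F m n) ⊙s sid (natO α E))
        ·d assoc (Fp F m) (Fp F n) (natO α E)
        ·d (sid (Fp F m) ⊙s natP α n)
        ·d associ (Fp F m) (natO α B) (Fp G n)
        ·d (natP α m ⊙s sid (Fp G n))
        ·d assoc (natO α A) (Fp G m) (Fp G n);
  nat_sq : forall (X Y Z W : Ob C) (f : Arr X Y) (g : Arr Z W) (m : Pro X Z)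
      (n : Pro Y W) (φ : Sq f g m n),
      (Fs F φ ⊙s natA α g) ·s natP α n ≡ natP α m ·s (natA α f ⊙s Fs G φ)
}.

Record NatTrans := {
  nat_data :> NatData;
  nat_laws : is_natural nat_data
}.

End Natural.

(** * Dinatural transformations *)

(** Coherators for a functor of two variables.  By strictness of [F], the
    domain and the codomain of [bsplitl], [bsplitr] and [bswap] are images of
    proarrows of [dprod K L] related by unitors in each component; for instance
    [bswap] is F(U,q) ⊙ F(p,U) = F(U ⊙ p, q ⊙ U) ≅ F(p ⊙ U, U ⊙ q)
    = F(p,U) ⊙ F(U,q). *)
Section Bifunctor.
Variables (K L D : DoubleCategory) (F : Functor (dprod K L) D).

Definition Fp2 (X X' : Ob K) (Y Y' : Ob L) (p : Pro X X') (q : Pro Y Y') :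
    Pro (F (X, Y)) (F (X', Y')) :=
  @Fp _ _ F (X, Y) (X', Y') (p, q).

Definition Fa2 (X X' : Ob K) (Y Y' : Ob L) (f : Arr X X') (g : Arr Y Y') :
    Arr (F (X, Y)) (F (X', Y')) :=
  @Fa _ _ F (X, Y) (X', Y') (f, g).

Definition Fs2 (X1 X2 X3 X4 : Ob K) (Y1 Y2 Y3 Y4 : Ob L)
    (f : Arr X1 X2) (g : Arr X3 X4) (m : Pro X1 X3) (n : Pro X2 X4)
    (f' : Arr Y1 Y2) (g' : Arr Y3 Y4) (m' : Pro Y1 Y3) (n' : Pro Y2 Y4)
    (φ : Sq f g m n) (ψ : Sq f' g' m' n') :
    Sq (Fa2 f f') (Fa2 g g') (Fp2 m m') (Fp2 n n') :=
  @Fs _ _ F (X1, Y1) (X2, Y2) (X3, Y3) (X4, Y4)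
    (f, f') (g, g') (m, m') (n, n') (φ, ψ).

Definition Fd2 (X X' : Ob K) (Y Y' : Ob L) (p p' : Pro X X') (q q' : Pro Y Y')
    (φ : Disk p p') (ψ : Disk q q') : Disk (Fp2 p q) (Fp2 p' q') :=
  @Fd _ _ F (X, Y) (X', Y') (p, q) (p', q') (φ, ψ).

Definition Fp2_comp (X X' X'' : Ob K) (Y Y' Y'' : Ob L) (p : Pro X X')
    (p' : Pro X' X'') (q : Pro Y Y') (q' : Pro Y' Y'') :
    Fp2 (p ⊙ p') (q ⊙ q') = Fp2 p q ⊙ Fp2 p' q' :=
  @Fp_comp _ _ F (X, Y) (X', Y') (X'', Y'') (p, q) (p', q').

Definition bsplitl (X X' X'' : Ob K) (p : Pro X X') (p' : Pro X' X'') (Y : Ob L) :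
    Disk (Fp2 (p ⊙ p') (U Y)) (Fp2 p (U Y) ⊙ Fp2 p' (U Y)) :=
  Fd2 (sid (p ⊙ p')) (luniti (U Y)) ·d eqd (Fp2_comp p p' (U Y) (U Y)).

Definition bsplitr (X : Ob K) (Y Y' Y'' : Ob L) (q : Pro Y Y') (q' : Pro Y' Y'') :
    Disk (Fp2 (U X) (q ⊙ q')) (Fp2 (U X) q ⊙ Fp2 (U X) q') :=
  Fd2 (luniti (U X)) (sid (q ⊙ q')) ·d eqd (Fp2_comp (U X) (U X) q q').

Definition bswap (X X' : Ob K) (Y Y' : Ob L) (p : Pro X X') (q : Pro Y Y') :
    Disk (Fp2 (U X) q ⊙ Fp2 p (U Y')) (Fp2 p (U Y) ⊙ Fp2 (U X') q) :=
  eqd (eq_sym (Fp2_comp (U X) p q (U Y')))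
  ·d Fd2 (lunit p ·d runiti p) (runit q ·d luniti q)
  ·d eqd (Fp2_comp p (U X') (U Y) q).

End Bifunctor.

Section Rebracket.
Variables (D : DoubleCategory) (X1 X2 X3 X4 X5 X6 : Ob D).
Variables (x : Pro X1 X2) (y : Pro X2 X3) (a : Pro X3 X4) (z : Pro X4 X5) (w : Pro X5 X6).

Definition nest : Disk (((x ⊙ y) ⊙ a) ⊙ (z ⊙ w)) ((x ⊙ ((y ⊙ a) ⊙ z)) ⊙ w) :=
  associ ((x ⊙ y) ⊙ a) z w
  ·d ((assoc x y a ⊙s sid z) ⊙s sid w)
  ·d (assoc x (y ⊙ a) z ⊙s sid w).

Definition unnest : Disk ((x ⊙ ((y ⊙ a) ⊙ z)) ⊙ w) (((x ⊙ y) ⊙ a) ⊙ (z ⊙ w)) :=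
  (associ x (y ⊙ a) z ⊙s sid w)
  ·d ((associ x y a ⊙s sid z) ⊙s sid w)
  ·d assoc ((x ⊙ y) ⊙ a) z w.

End Rebracket.

Definition Difunctor (C D : DoubleCategory) := Functor (dprod (refl C) C) D.

Section Dinatural.
Variables (C D : DoubleCategory) (F G : Difunctor C D).

(** A proarrow or square of [C] (in particular [U A] and [Us f]) seen in its reflection. *)
Definition rp (A B : Ob C) (m : Pro A B) : @Pro (refl C) B A := m.
Definition rs (X Y Z W : Ob C) (f : Arr X Y) (g : Arr Z W) (m : Pro X Z)
    (n : Pro Y W) (φ : Sq f g m n) : @Sq (refl C) Z W X Y g f (rp m) (rp n) := φ.

(** The composites of the form F ⊙ α ⊙ G are bracketed to the left. *)
Record DinatData := {
  dinO : forall A : Ob C, Pro (F (A, A)) (G (A, A));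
  dinA : forall (A B : Ob C) (f : Arr A B),
      Sq (@Fa2 (refl C) C D F A B A B f f) (@Fa2 (refl C) C D G A B A B f f)
         (dinO A) (dinO B);
  dinP : forall (A B : Ob C) (m : Pro A B),
      Disk ((Fp2 F (rp (U B)) m ⊙ dinO B) ⊙ Fp2 G (rp m) (U B))
           ((Fp2 F (rp m) (U A) ⊙ dinO A) ⊙ Fp2 G (rp (U A)) m)
}.

(** Coherator from F(U,U) ⊙ a ⊙ G(U,U) to a. *)
Definition dunit (A : Ob C) (a : Pro (F (A, A)) (G (A, A))) :
    Disk ((Fp2 F (rp (U A)) (U A) ⊙ a) ⊙ Fp2 G (rp (U A)) (U A)) a :=
  ((eqd (Fp_U F (A, A)) ⊙s sid a) ⊙s eqd (Fp_U G (A, A)))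
  ·d (lunit a ⊙s sid (U (G (A, A))))
  ·d runit a.

(** In [dinP_comp] the disks other than those built from [dinP] are coherators.
    Note that [rp n] and [rp m] compose in this order in [refl C]. *)
Record is_dinatural (α : DinatData) : Prop := {
  dinP_inv : forall (A B : Ob C) (m : Pro A B), invertible (dinP α m);
  dinA_id : forall A : Ob C, dinA α (aid A) ≡ sid (dinO α A);
  dinA_comp : forall (A B E : Ob C) (f : Arr A B) (g : Arr B E),
      dinA α (f · g) ≡ dinA α f ·s dinA α g;
  dinP_U : forall A : Ob C,
      dinP α (U A) ·d dunit (dinO α A) = dunit (dinO α A) ·d sid (dinO α A);
  dinP_comp : forall (A B E : Ob C) (m : Pro A B) (n : Pro B E),
      dinP α (m ⊙ n)
        ·d ((bsplitl F (rp n) (rp m) A ⊙s sid (dinO α A))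
            ⊙s bsplitr G (A : Ob (refl C)) m n)
      = ((bsplitr F (E : Ob (refl C)) m n ⊙s sid (dinO α E))
          ⊙s bsplitl G (rp n) (rp m) E)
        ·d nest (Fp2 F (rp (U E)) m) (Fp2 F (rp (U E)) n) (dinO α E)
                (Fp2 G (rp n) (U E)) (Fp2 G (rp m) (U E))
        ·d ((sid (Fp2 F (rp (U E)) m) ⊙s dinP α n) ⊙s sid (Fp2 G (rp m) (U E)))
        ·d unnest (Fp2 F (rp (U E)) m) (Fp2 F (rp n) (U B)) (dinO α B)
                  (Fp2 G (rp (U B)) n) (Fp2 G (rp m) (U E))
        ·d ((bswap F (rp n) m ⊙s sid (dinO α B)) ⊙s bswap G (rp m) n)
        ·d nest (Fp2 F (rp n) (U A)) (Fp2 F (rp (U B)) m) (dinO α B)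
                (Fp2 G (rp m) (U B)) (Fp2 G (rp (U A)) n)
        ·d ((sid (Fp2 F (rp n) (U A)) ⊙s dinP α m) ⊙s sid (Fp2 G (rp (U A)) n))
        ·d unnest (Fp2 F (rp n) (U A)) (Fp2 F (rp m) (U A)) (dinO α A)
                  (Fp2 G (rp (U A)) m) (Fp2 G (rp (U A)) n);
  dinat_sq : forall (X Y Z W : Ob C) (f : Arr X Y) (g : Arr Z W) (m : Pro X Z)
      (n : Pro Y W) (φ : Sq f g m n),
      ((Fs2 F (rs (Us g)) φ ⊙s dinA α g) ⊙s Fs2 G (rs φ) (Us g)) ·s dinP α n
      ≡ dinP α m ·s ((Fs2 F (rs φ) (Us f) ⊙s dinA α f) ⊙s Fs2 G (rs (Us f)) φ)
}.

Record DinatTrans := {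
  dinat_data :> DinatData;
  dinat_laws : is_dinatural dinat_data
}.

End Dinatural.

(** * Dummy constructions *)

Definition dummy_difunctor (C D : DoubleCategory) (F : Functor C D) : Difunctor C D :=
  fcomp (fsnd (refl C) C) F.

(** The proarrow component is [natP α m] up to unitors, since the dummy
    difunctors send [(m, U A)] to the image of [U A]. *)
Definition dummy_data (C D : DoubleCategory) (F G : Functor C D) (α : NatData F G) :
    DinatData (dummy_difunctor F) (dummy_difunctor G) :=
  @Build_DinatData C D (dummy_difunctor F) (dummy_difunctor G)
    (fun A => natO α A)
    (fun A B f => natA α f)
    (fun A B m =>
       ((sid (Fp F m ⊙ natO α B) ⊙s eqd (Fp_U G B)) ·d runit (Fp F m ⊙ natO α B))
       ·d natP α m
       ·d ((luniti (natO α A) ·d (eqd (eq_sym (Fp_U F A)) ⊙s sid (natO α A)))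
           ⊙s sid (Fp G m))).

(* Main.v *)
(** Since a dummy difunctor ignores its first variable, the proarrow component of
    a dinatural transformation between dummy difunctors is a disk
    (Fm ⊙ αB) ⊙ U → (U ⊙ αA) ⊙ Gm.  Pasting with the unitors of the two outer
    units ([twist]) is a bijection from disks Fm ⊙ αB → αA ⊙ Gm, and each
    dinaturality law is the corresponding naturality law pasted with invertible
    disks.  Only compatibility with ⊙ needs real coherence: between two
    consecutive components the units must cancel, which follows from naturality
    of the coherators and Kelly's lemmas on unitors of composites. *)

From Stdlib Require Import FunctionalExtensionality ProofIrrelevance.
Require Import Defs.

Set Implicit Arguments.
Unset Strict Implicit.
Unset Printing Implicit Defensive.

Local Open Scope dbl_scope.

(** * Equational calculus of disks *)

Section Disks.
Variable D : DoubleCategory.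
Let L := dc_laws D.

Lemma dcomp_eq (X Y : Ob D) (m n p : Pro X Y) (φ : Disk m n) (ψ : Disk n p) :
  φ ·d ψ ≡ φ ·s ψ.
Proof. apply retype_eq. Qed.

Lemma dcompA (X Y : Ob D) (m n p q : Pro X Y)
    (φ : Disk m n) (ψ : Disk n p) (χ : Disk p q) :
  (φ ·d ψ) ·d χ = φ ·d (ψ ·d χ).
Proof.
apply sq_eqE.
apply (sq_trans (dcomp_eq _ _)).
apply (sq_trans (scomp_eq (dcomp_eq _ _) (sq_refl _))).
apply (sq_trans (sassoc L _ _ _)).
apply sq_sym, (sq_trans (dcomp_eq _ _)).
apply (scomp_eq (sq_refl _) (dcomp_eq _ _)).
Qed.

Lemma dcomp_sidl (X Y : Ob D) (m n : Pro X Y) (φ : Disk m n) : sid m ·d φ = φ.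
Proof. apply sq_eqE, (sq_trans (dcomp_eq _ _)), (sidl L). Qed.

Lemma dcomp_sidr (X Y : Ob D) (m n : Pro X Y) (φ : Disk m n) : φ ·d sid n = φ.
Proof. apply sq_eqE, (sq_trans (dcomp_eq _ _)), (sidr L). Qed.

Lemma disk_interchange (X Y Z : Ob D) (m m' m'' : Pro X Y) (n n' n'' : Pro Y Z)
    (φ : Disk m m') (φ' : Disk m' m'') (ψ : Disk n n') (ψ' : Disk n' n'') :
  (φ ⊙s ψ) ·d (φ' ⊙s ψ') = (φ ·d φ') ⊙s (ψ ·d ψ').
Proof.
apply sq_eqE, (sq_trans (dcomp_eq _ _)).
rewrite <- (interchange L).
apply scompp_eq; apply sq_sym, dcomp_eq.
Qed.

Lemma sid_scompp (X Y Z : Ob D) (m : Pro X Y) (n : Pro Y Z) :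
  sid m ⊙s sid n = sid (m ⊙ n).
Proof. symmetry; apply (sid_pcomp L). Qed.

Lemma assocdK (X Y Z W : Ob D) (m : Pro X Y) (n : Pro Y Z) (p : Pro Z W) :
  assoc m n p ·d associ m n p = sid _.
Proof. apply sq_eqE, (sq_trans (dcomp_eq _ _)), (associK L). Qed.

Lemma associdK (X Y Z W : Ob D) (m : Pro X Y) (n : Pro Y Z) (p : Pro Z W) :
  associ m n p ·d assoc m n p = sid _.
Proof. apply sq_eqE, (sq_trans (dcomp_eq _ _)), (assocK L). Qed.

Lemma lunitdK (X Y : Ob D) (m : Pro X Y) : lunit m ·d luniti m = sid _.
Proof. apply sq_eqE, (sq_trans (dcomp_eq _ _)), (lunitiK L). Qed.

Lemma lunitidK (X Y : Ob D) (m : Pro X Y) : luniti m ·d lunit m = sid _.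
Proof. apply sq_eqE, (sq_trans (dcomp_eq _ _)), (lunitK L). Qed.

Lemma runitdK (X Y : Ob D) (m : Pro X Y) : runit m ·d runiti m = sid _.
Proof. apply sq_eqE, (sq_trans (dcomp_eq _ _)), (runitiK L). Qed.

Lemma runitidK (X Y : Ob D) (m : Pro X Y) : runiti m ·d runit m = sid _.
Proof. apply sq_eqE, (sq_trans (dcomp_eq _ _)), (runitK L). Qed.

Lemma disk_assoc_nat (X Y Z W : Ob D) (m m' : Pro X Y) (n n' : Pro Y Z)
    (p p' : Pro Z W) (φ : Disk m m') (ψ : Disk n n') (χ : Disk p p') :
  ((φ ⊙s ψ) ⊙s χ) ·d assoc m' n' p' = assoc m n p ·d (φ ⊙s (ψ ⊙s χ)).
Proof.
apply sq_eqE, (sq_trans (dcomp_eq _ _)), (sq_trans (assoc_nat L _ _ _)).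
apply sq_sym, dcomp_eq.
Qed.

Lemma disk_lunit_nat (X Y : Ob D) (m n : Pro X Y) (φ : Disk m n) :
  (sid (U X) ⊙s φ) ·d lunit n = lunit m ·d φ.
Proof.
apply sq_eqE, (sq_trans (dcomp_eq _ _)).
rewrite <- (Us_id L); apply (sq_trans (lunit_nat L _)), sq_sym, dcomp_eq.
Qed.

Lemma disk_runit_nat (X Y : Ob D) (m n : Pro X Y) (φ : Disk m n) :
  (φ ⊙s sid (U Y)) ·d runit n = runit m ·d φ.
Proof.
apply sq_eqE, (sq_trans (dcomp_eq _ _)).
rewrite <- (Us_id L); apply (sq_trans (runit_nat L _)), sq_sym, dcomp_eq.
Qed.

Lemma disk_pentagon (X Y Z W V : Ob D) (m : Pro X Y) (n : Pro Y Z) (p : Pro Z W)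
    (q : Pro W V) :
  assoc (m ⊙ n) p q ·d assoc m n (p ⊙ q)
  = (assoc m n p ⊙s sid q) ·d (assoc m (n ⊙ p) q ·d (sid m ⊙s assoc n p q)).
Proof.
rewrite <- dcompA; apply sq_eqE, (sq_trans (dcomp_eq _ _)).
apply (sq_trans (pentagon L _ _ _ _)), sq_sym, (sq_trans (dcomp_eq _ _)).
apply (scomp_eq (dcomp_eq _ _) (sq_refl _)).
Qed.

Lemma disk_triangle (X Y Z : Ob D) (m : Pro X Y) (n : Pro Y Z) :
  assoc m (U Y) n ·d (sid m ⊙s lunit n) = runit m ⊙s sid n.
Proof. apply sq_eqE, (sq_trans (dcomp_eq _ _)), (triangle L). Qed.

(** Lets an equation between short composites act inside a longer one bracketed to the right, the
    normal form of the rewriting below. *)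
Lemma dcomp_post (X Y : Ob D) (m n p q : Pro X Y) (φ : Disk m n) (ψ : Disk n p)
    (χ : Disk m p) : φ ·d ψ = χ -> forall ω : Disk p q, φ ·d (ψ ·d ω) = χ ·d ω.
Proof. intros <- ω; symmetry; apply dcompA. Qed.

Lemma dcomp_epi (X Y : Ob D) (m n p : Pro X Y) (φ : Disk m n) (φi : Disk n m)
    (ψ ψ' : Disk n p) : φi ·d φ = sid n -> φ ·d ψ = φ ·d ψ' -> ψ = ψ'.
Proof.
intros H E. rewrite <- (dcomp_sidl ψ), <- (dcomp_sidl ψ'), <- H, !dcompA.
now rewrite E.
Qed.

Lemma dcomp_mono (X Y : Ob D) (m n p : Pro X Y) (φ : Disk m n) (φi : Disk n m)
    (ψ ψ' : Disk p m) : φ ·d φi = sid m -> ψ ·d φ = ψ' ·d φ -> ψ = ψ'.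
Proof.
intros H E. rewrite <- (dcomp_sidr ψ), <- (dcomp_sidr ψ'), <- H, <- !dcompA.
now rewrite E.
Qed.

Lemma scompp_dcompl (X Y Z : Ob D) (m m' m'' : Pro X Y) (n : Pro Y Z)
    (φ : Disk m m') (φ' : Disk m' m'') :
  (φ ⊙s sid n) ·d (φ' ⊙s sid n) = (φ ·d φ') ⊙s sid n.
Proof. now rewrite disk_interchange, dcomp_sidl. Qed.

Lemma scompp_dcompr (X Y Z : Ob D) (m : Pro X Y) (n n' n'' : Pro Y Z)
    (φ : Disk n n') (φ' : Disk n' n'') :
  (sid m ⊙s φ) ·d (sid m ⊙s φ') = sid m ⊙s (φ ·d φ').
Proof. now rewrite disk_interchange, dcomp_sidl. Qed.

(** Naturality of [lunit] recovers a disk from its whiskering with [U X], by conjugation with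
    unitors. *)
Lemma scompp_sidl_inj (X Y : Ob D) (m n : Pro X Y) (φ ψ : Disk m n) :
  sid (U X) ⊙s φ = sid (U X) ⊙s ψ -> φ = ψ.
Proof.
intros E. apply dcomp_epi with (1 := lunitidK m).
now rewrite <- !disk_lunit_nat, E.
Qed.

Lemma scompp_sidr_inj (X Y : Ob D) (m n : Pro X Y) (φ ψ : Disk m n) :
  φ ⊙s sid (U Y) = ψ ⊙s sid (U Y) -> φ = ψ.
Proof.
intros E. apply dcomp_epi with (1 := runitidK m).
now rewrite <- !disk_runit_nat, E.
Qed.

(** * Kelly's consequences of the triangle and pentagon axioms *)

(* [U ⊙ -] is faithful, so the equation may be checked inside a pentagon. *)
Lemma lunit_pcomp (X Y Z : Ob D) (m : Pro X Y) (n : Pro Y Z) :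
  assoc (U X) m n ·d lunit (m ⊙ n) = lunit m ⊙s sid n.
Proof.
apply scompp_sidl_inj.
apply dcomp_epi with (1 := associdK (U X) (U X ⊙ m) n).
apply dcomp_epi with (φ := assoc (U X) (U X) m ⊙s sid n)
  (φi := associ (U X) (U X) m ⊙s sid n).
{ rewrite scompp_dcompl, associdK; apply sid_scompp. }
rewrite <- scompp_dcompr, <- disk_assoc_nat.
rewrite <- (dcompA (assoc _ _ n)), <- (dcompA (assoc _ _ m ⊙s _)).
rewrite <- disk_pentagon, dcompA, disk_triangle, <- sid_scompp, <- disk_assoc_nat.
rewrite <- (disk_triangle (U X) m), <- scompp_dcompl.
apply dcompA.
Qed.

(** Mirror image of [lunit_pcomp]: whisker with the unit on the right and compare inside the
    pentagon whose last two proarrows are units. *)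
Lemma runit_pcomp (X Y Z : Ob D) (m : Pro X Y) (n : Pro Y Z) :
  assoc m n (U Z) ·d (sid m ⊙s runit n) = runit (m ⊙ n).
Proof.
apply scompp_sidr_inj.
apply dcomp_mono with (1 := assocdK m n (U Z)).
rewrite <- scompp_dcompl, dcompA, disk_assoc_nat, <- disk_triangle, <- scompp_dcompr.
rewrite <- (dcompA (assoc m _ _)), <- dcompA, <- disk_pentagon, dcompA.
rewrite <- disk_assoc_nat, <- dcompA, sid_scompp.
now rewrite disk_triangle.
Qed.

(** After whiskering with [U X], the triangle and [lunit_pcomp] reduce the claim to [lunit (U X ⊙ U
    X) = sid (U X) ⊙s lunit (U X)], which is naturality of [lunit] at [lunit (U X)] itself. *)
Lemma lunit_U (X : Ob D) : lunit (U X) = runit (U X).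
Proof.
apply scompp_sidr_inj.
rewrite <- disk_triangle, <- lunit_pcomp. f_equal.
apply dcomp_mono with (1 := lunitdK (U X)).
symmetry; apply disk_lunit_nat.
Qed.

Lemma luniti_U (X : Ob D) : luniti (U X) = runiti (U X).
Proof.
apply dcomp_epi with (1 := lunitidK (U X)).
now rewrite lunitdK, lunit_U, runitdK.
Qed.

Lemma associ_runit (X Y Z : Ob D) (m : Pro X Y) (n : Pro Y Z) :
  associ m (U Y) n ·d (runit m ⊙s sid n) = sid m ⊙s lunit n.
Proof.
apply dcomp_epi with (1 := associdK m (U Y) n).
now rewrite <- dcompA, assocdK, dcomp_sidl, disk_triangle.
Qed.

Lemma disk_associ_nat (X Y Z W : Ob D) (m m' : Pro X Y) (n n' : Pro Y Z)
    (p p' : Pro Z W) (φ : Disk m m') (ψ : Disk n n') (χ : Disk p p') :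
  (φ ⊙s (ψ ⊙s χ)) ·d associ m' n' p' = associ m n p ·d ((φ ⊙s ψ) ⊙s χ).
Proof.
apply dcomp_epi with (1 := associdK m n p).
rewrite <- !dcompA, assocdK, dcomp_sidl, <- disk_assoc_nat, dcompA, assocdK.
apply dcomp_sidr.
Qed.

Lemma luniti_pcomp (X Y Z : Ob D) (m : Pro X Y) (n : Pro Y Z) :
  (luniti m ⊙s sid n) ·d assoc (U X) m n = luniti (m ⊙ n).
Proof.
apply dcomp_mono with (1 := lunitdK (m ⊙ n)).
rewrite lunitidK, dcompA, lunit_pcomp, scompp_dcompl, lunitidK.
apply sid_scompp.
Qed.

Lemma lunit_luniti (X Y Z : Ob D) (m : Pro X Y) (n : Pro Y Z) :
  lunit (m ⊙ n) ·d (luniti m ⊙s sid n) = associ (U X) m n.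
Proof.
apply dcomp_mono with (1 := assocdK (U X) m n).
now rewrite dcompA, luniti_pcomp, lunitdK, associdK.
Qed.

(** Both sides become the identity after [runit (U X) ⊙s sid m]: the left one because the two
    unitors agree on [U X], the right one by the triangle. *)
Lemma luniti_associ (X Y : Ob D) (m : Pro X Y) :
  luniti (U X) ⊙s sid m = (sid (U X) ⊙s luniti m) ·d associ (U X) (U X) m.
Proof.
apply dcomp_mono with (φ := runit (U X) ⊙s sid m) (φi := runiti (U X) ⊙s sid m).
{ rewrite scompp_dcompl, runitdK; apply sid_scompp. }
rewrite dcompA, associ_runit, luniti_U, scompp_dcompl, scompp_dcompr.
now rewrite runitidK, lunitidK.
Qed.

(** * Cancellation of units between consecutive components *)

(** The unit doubled by [bsplitl] on the [G] side is absorbed by the right unitor that opens the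
    first pasted component. *)
Lemma nest_runit (X Y Z W : Ob D) (p : Pro X Y) (q : Pro Y Z) (c : Pro Z W) :
  (sid ((p ⊙ q) ⊙ c) ⊙s luniti (U W))
  ·d (nest p q c (U W) (U W) ·d ((sid p ⊙s runit (q ⊙ c)) ⊙s sid (U W)))
  = assoc p q c ⊙s sid (U W).
Proof.
unfold nest. rewrite !dcompA.
rewrite scompp_dcompl, runit_pcomp, scompp_dcompl, disk_runit_nat, <- scompp_dcompl.
rewrite (dcomp_post (associ_runit _ _)), <- dcompA, scompp_dcompr, lunitidK.
now rewrite sid_scompp, dcomp_sidl.
Qed.

(** The unit that the first component inserts before [b] is absorbed by the unit-removing half of
    [bswap] on the [F] side; the outer unit on the right moves to the front by naturality. *)
Lemma unnest_runit (X Y Z W : Ob D) (p : Pro X Y) (b : Pro Y Z) (s : Pro Z W) :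
  ((sid p ⊙s (luniti b ⊙s sid s)) ⊙s sid (U W))
  ·d (unnest p (U Y) b s (U W) ·d ((runit p ⊙s sid b) ⊙s runit s))
  = runit (p ⊙ (b ⊙ s)) ·d associ p b s.
Proof.
(* [runit s] is split off because it combines with the last associator of [unnest] into the unitor
   of the whole composite, while [runit p] is needed to cancel [luniti b]. *)
replace ((runit p ⊙s sid b) ⊙s runit s)
  with ((sid _ ⊙s runit s) ·d ((runit p ⊙s sid b) ⊙s sid s))
  by now rewrite disk_interchange, dcomp_sidl, dcomp_sidr.
unfold unnest. rewrite !dcompA, (dcomp_post (runit_pcomp _ _)).
rewrite (dcomp_post (disk_runit_nat _)), dcompA.
rewrite (dcomp_post (disk_runit_nat _)), dcompA.
rewrite (dcomp_post (disk_runit_nat _)), dcompA. f_equal.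
rewrite scompp_dcompl, associ_runit, <- disk_associ_nat, <- dcompA.
rewrite scompp_dcompr, scompp_dcompl, lunitidK, !sid_scompp.
apply dcomp_sidl.
Qed.

(** The unit inserted before [s] by [bswap] on the [G] side is absorbed by the right unitor that
    opens the second component; only the unit on the far left survives. *)
Lemma nest_luniti (X Y Z W : Ob D) (p : Pro X Y) (b : Pro Y Z) (s : Pro Z W) :
  ((luniti p ⊙s sid b) ⊙s luniti s)
  ·d (nest (U X) p b (U Z) s ·d ((sid (U X) ⊙s runit (p ⊙ b)) ⊙s sid s))
  = luniti (p ⊙ b) ⊙s sid s.
Proof.
unfold nest. rewrite !dcompA.
rewrite scompp_dcompl, runit_pcomp, scompp_dcompl, disk_runit_nat, <- scompp_dcompl.
rewrite (dcomp_post (associ_runit _ _)), <- dcompA, disk_interchange, lunitidK.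
rewrite dcomp_sidr, scompp_dcompl. now rewrite luniti_pcomp.
Qed.

(** The left unit surviving from [nest_luniti] is removed by [lunit (a ⊙ r)]. The two units required
    in the codomain are reinserted at the very end, in the form in which [twistl] followed by
    [bsplitl] inserts them on the other side of the law. *)
Lemma unnest_luniti (X Y Z W : Ob D) (a : Pro X Y) (r : Pro Y Z) (s : Pro Z W) :
  ((sid (U X) ⊙s (luniti a ⊙s sid r)) ⊙s sid s) ·d unnest (U X) (U X) a r s
  = (lunit (a ⊙ r) ⊙s sid s) ·d (assoc a r s ·d ((luniti a ⊙s sid (r ⊙ s))
      ·d ((luniti (U X) ⊙s sid a) ⊙s sid (r ⊙ s)))).
Proof.
rewrite scompp_dcompl, <- (sid_scompp r s), <- disk_assoc_nat, <- dcompA.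
unfold unnest. rewrite <- !dcompA. f_equal. rewrite !scompp_dcompl. f_equal.
rewrite luniti_associ, <- !scompp_dcompl, <- !dcompA, lunit_luniti.
now rewrite disk_associ_nat.
Qed.

(** * Pasting with unitors *)

Lemma invertible_dcomp (X Y : Ob D) (m n p : Pro X Y) (φ : Disk m n) (ψ : Disk n p) :
  invertible φ -> invertible ψ -> invertible (φ ·d ψ).
Proof.
intros (φi & H1 & H2) (ψi & K1 & K2). exists (ψi ·d φi). split.
- now rewrite dcompA, <- (dcompA ψ), K1, dcomp_sidl.
- now rewrite dcompA, <- (dcompA φi), H2, dcomp_sidl.
Qed.

Section Twist.
Variables (X Y Z W : Ob D) (u : Pro X X) (v : Pro W W) (eu : u = U X) (ev : v = U W).
Variables (p : Pro X Y) (b : Pro Y W) (a : Pro X Z) (r : Pro Z W).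

Definition twistr : Disk ((p ⊙ b) ⊙ v) (p ⊙ b) :=
  (sid (p ⊙ b) ⊙s eqd ev) ·d runit (p ⊙ b).
Definition twistri : Disk (p ⊙ b) ((p ⊙ b) ⊙ v) :=
  runiti (p ⊙ b) ·d (sid (p ⊙ b) ⊙s eqd (eq_sym ev)).
Definition twistl : Disk (a ⊙ r) ((u ⊙ a) ⊙ r) :=
  (luniti a ·d (eqd (eq_sym eu) ⊙s sid a)) ⊙s sid r.
Definition twistli : Disk ((u ⊙ a) ⊙ r) (a ⊙ r) :=
  ((eqd eu ⊙s sid a) ·d lunit a) ⊙s sid r.

(** With [u] and [v] the images of units under [F] and [G], this unfolds to the proarrow component
    in [dummy_data]. *)
Definition twist (φ : Disk (p ⊙ b) (a ⊙ r)) : Disk ((p ⊙ b) ⊙ v) ((u ⊙ a) ⊙ r) :=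
  (twistr ·d φ) ·d twistl.
Definition untwist (φ : Disk ((p ⊙ b) ⊙ v) ((u ⊙ a) ⊙ r)) : Disk (p ⊙ b) (a ⊙ r) :=
  (twistri ·d φ) ·d twistli.

Lemma twistrK : twistr ·d twistri = sid _.
Proof.
unfold twistr, twistri; subst; cbn.
now rewrite sid_scompp, dcomp_sidl, dcomp_sidr, runitdK.
Qed.

Lemma twistriK : twistri ·d twistr = sid _.
Proof.
unfold twistr, twistri; subst; cbn.
now rewrite sid_scompp, dcomp_sidl, dcomp_sidr, runitidK.
Qed.

Lemma twistlK : twistl ·d twistli = sid _.
Proof.
unfold twistl, twistli; subst; cbn.
now rewrite !sid_scompp, dcomp_sidl, dcomp_sidr, scompp_dcompl, lunitidK, sid_scompp.
Qed.

Lemma twistliK : twistli ·d twistl = sid _.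
Proof.
unfold twistl, twistli; subst; cbn.
now rewrite !sid_scompp, dcomp_sidl, dcomp_sidr, scompp_dcompl, lunitdK, sid_scompp.
Qed.

Lemma twistK (φ : Disk (p ⊙ b) (a ⊙ r)) : untwist (twist φ) = φ.
Proof.
unfold twist, untwist.
now rewrite !dcompA, twistlK, dcomp_sidr, <- dcompA, twistriK, dcomp_sidl.
Qed.

Lemma untwistK (φ : Disk ((p ⊙ b) ⊙ v) ((u ⊙ a) ⊙ r)) : twist (untwist φ) = φ.
Proof.
unfold twist, untwist.
now rewrite !dcompA, twistliK, dcomp_sidr, <- dcompA, twistrK, dcomp_sidl.
Qed.

Lemma invertible_twist (φ : Disk (p ⊙ b) (a ⊙ r)) :
  invertible (twist φ) <-> invertible φ.
Proof.
split; intros H.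
- rewrite <- twistK. unfold untwist.
  apply invertible_dcomp; [apply invertible_dcomp; [|exact H]|].
  + exists twistr; split; [apply twistriK|apply twistrK].
  + exists twistl; split; [apply twistliK|apply twistlK].
- unfold twist.
  apply invertible_dcomp; [apply invertible_dcomp; [|exact H]|].
  + exists twistri; split; [apply twistrK|apply twistriK].
  + exists twistli; split; [apply twistlK|apply twistliK].
Qed.

End Twist.

(** Two proofs of each unit equation occur, because [dunit] uses that of the composite functor and
    [twist] that of the original one. Once they are identified, the two laws differ by
    precomposition with the invertible [runit (U X ⊙ a)]. *)
Lemma twist_unit (X Y : Ob D) (u : Pro X X) (v : Pro Y Y) (eu eu' : u = U X)
    (ev ev' : v = U Y) (a : Pro X Y) (φ : Disk (u ⊙ a) (a ⊙ v)) :
  twist eu ev φ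
    ·d (((eqd eu' ⊙s sid a) ⊙s eqd ev') ·d (lunit a ⊙s sid (U Y)) ·d runit a)
  = (((eqd eu' ⊙s sid a) ⊙s eqd ev') ·d (lunit a ⊙s sid (U Y)) ·d runit a) ·d sid a
  <-> φ ·d ((sid a ⊙s eqd ev) ·d runit a) = ((eqd eu ⊙s sid a) ·d lunit a) ·d sid a.
Proof.
rewrite (proof_irrelevance _ eu' eu), (proof_irrelevance _ ev' ev).
unfold twist, twistr, twistl; subst; cbn.
rewrite !sid_scompp, !dcomp_sidl, !dcomp_sidr, !dcompA.
rewrite (dcomp_post (scompp_dcompl _ _ _)), lunitidK, sid_scompp, dcomp_sidl.
rewrite disk_runit_nat.
split; [apply dcomp_epi with (1 := runitidK _)|now intros ->].
Qed.

(** The unit images [uX], …, [vZ] and the composites [pq], [rs] are variables so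
    that the propositional equations [Fp_U] and [Fp_comp] can be eliminated; the
    hypotheses on [lF], …, [wG] are what the coherators of [dinP_comp] become on
    dummy difunctors. *)
Lemma twist_comp (X Y Z X' Y' Z' : Ob D)
    (uX : Pro X X) (uY : Pro Y Y) (vY : Pro Y' Y') (vZ : Pro Z' Z')
    (eX : uX = U X) (eY : uY = U Y) (fY : vY = U Y') (fZ : vZ = U Z')
    (p : Pro X Y) (q : Pro Y Z) (pq : Pro X Z) (epq : pq = p ⊙ q)
    (r : Pro X' Y') (s : Pro Y' Z') (rs : Pro X' Z') (ers : rs = r ⊙ s)
    (a : Pro X X') (b : Pro Y Y') (c : Pro Z Z')
    (φ : Disk (p ⊙ b) (a ⊙ r)) (ψ : Disk (q ⊙ c) (b ⊙ s)) (χ : Disk (pq ⊙ c) (a ⊙ rs))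
    (lF : Disk uX (uX ⊙ uX)) (rF : Disk pq (p ⊙ q)) (wF : Disk (p ⊙ uY) (uX ⊙ p))
    (lG : Disk vZ (vZ ⊙ vZ)) (rG : Disk rs (r ⊙ s)) (wG : Disk (s ⊙ vZ) (vY ⊙ s)) :
  lF ≡ luniti (U X) -> lG ≡ luniti (U Z') -> rF ≡ sid pq -> rG ≡ sid rs ->
  wF ≡ runit p ·s luniti p -> wG ≡ runit s ·s luniti s ->
  twist eX fZ χ ·d ((lF ⊙s sid a) ⊙s rG)
  = ((rF ⊙s sid c) ⊙s lG)
    ·d nest p q c vZ vZ
    ·d ((sid p ⊙s twist eY fZ ψ) ⊙s sid vZ)
    ·d unnest p uY b s vZ
    ·d ((wF ⊙s sid b) ⊙s wG)
    ·d nest uX p b vY s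
    ·d ((sid uX ⊙s twist eX fY φ) ⊙s sid s)
    ·d unnest uX uX a r s
  <->
  χ ·d (sid a ⊙s eqd ers)
  = (eqd epq ⊙s sid c) ·d assoc p q c ·d (sid p ⊙s ψ) ·d associ p b s
    ·d (φ ⊙s sid s) ·d assoc a r s.
Proof.
(* With the unit and composition equations eliminated, the boundaries agree on the nose, so the
   coherators can be replaced by their values. *)
subst. intros ElF ElG ErF ErG EwF EwG.
apply sq_eqE in ElF, ElG, ErF, ErG.
apply (fun e => sq_trans e (sq_sym (dcomp_eq _ _))), sq_eqE in EwF, EwG. subst.
unfold twist, twistr, twistl; cbn.
rewrite !sid_scompp, !dcomp_sidl, !dcomp_sidr, !dcompA.
(* The swap is cut into a half removing units and a half inserting them, each of which cancels
   against the component next to it. *)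
replace ((runit p ·d luniti p ⊙s sid b) ⊙s (runit s ·d luniti s))
  with (((runit p ⊙s sid b) ⊙s runit s) ·d ((luniti p ⊙s sid b) ⊙s luniti s))
  by now rewrite disk_interchange, scompp_dcompl.
rewrite <- !scompp_dcompr, <- !scompp_dcompl.
(* [t] inserts the two units of the codomain. Both sides of the law end with it and begin with the
   same right unitor, so what lies between is the naturality law. *)
set (t := (luniti a ⊙s sid (r ⊙ s)) ·d ((luniti (U X) ⊙s sid a) ⊙s sid (r ⊙ s))).
assert (ti : t ·d ((lunit (U X) ⊙s sid a) ⊙s sid (r ⊙ s) ·d (lunit a ⊙s sid (r ⊙ s)))
    = sid _).
{ unfold t. rewrite !scompp_dcompl, dcompA, <- (dcompA (luniti (U X) ⊙s _)).
  now rewrite scompp_dcompl, lunitidK, sid_scompp, dcomp_sidl, lunitidK, sid_scompp. }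
match goal with |- _ = ?rhs <-> _ =>
  replace rhs with (runit _ ·d ((assoc p q c ·d ((sid p ⊙s ψ) ·d (associ p b s
    ·d ((φ ⊙s sid s) ·d assoc a r s)))) ·d t)) end.
- split; [|now intros ->].
  intros E. apply dcomp_mono with (1 := ti).
  apply dcomp_epi with (1 := runitidK _). exact E.
- symmetry. rewrite !dcompA.
  rewrite unnest_luniti. fold t.
  rewrite <- (dcompA (nest p q c _ _)), <- (dcompA (_ ⊙s luniti (U Z'))), nest_runit.
  rewrite <- (dcompA (unnest _ _ _ _ _)), <- (dcompA (_ ⊙s (luniti b ⊙s _) ⊙s _)), unnest_runit.
  rewrite <- (dcompA (nest _ _ _ _ _)), <- (dcompA (_ ⊙s luniti s)), nest_luniti.
  rewrite (dcomp_post (scompp_dcompl _ (_ ⊙s φ) _)), disk_lunit_nat.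
  rewrite (dcomp_post (scompp_dcompl _ (luniti _) _)), <- (dcompA (luniti _)).
  rewrite lunitidK, dcomp_sidl.
  rewrite !dcompA.
  rewrite (dcomp_post (disk_runit_nat _)), dcompA.
  now rewrite (dcomp_post (disk_runit_nat _)), dcompA.
Qed.

(** * Pasting with unitors against general squares *)

Lemma scomp_epi (X Y X' Y' : Ob D) (fi : Arr X X) (gi : Arr Y Y)
    (fa fb : Arr X X') (ga gb : Arr Y Y') (m n : Pro X Y) (p q : Pro X' Y')
    (φ : Disk m n) (φi : Sq fi gi n m) (ψ : Sq fa ga n p) (ψ' : Sq fb gb n q) :
  φi ·s φ ≡ sid n -> φ ·s ψ ≡ φ ·s ψ' -> ψ ≡ ψ'.
Proof.
intros H E.
apply (sq_trans (sq_sym (sidl L ψ))), (sq_trans (scomp_eq (sq_sym H) (sq_refl _))).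
apply (sq_trans (sassoc L _ _ _)), (sq_trans (scomp_eq (sq_refl _) E)).
apply (sq_trans (sq_sym (sassoc L _ _ _))), (sq_trans (scomp_eq H (sq_refl _))).
apply (sidl L).
Qed.

Lemma scomp_mono (X Y X' Y' : Ob D) (fi : Arr X X) (gi : Arr Y Y)
    (fa fb : Arr X' X) (ga gb : Arr Y' Y) (m n : Pro X Y) (p q : Pro X' Y')
    (φ : Disk m n) (φi : Sq fi gi n m) (ψ : Sq fa ga p m) (ψ' : Sq fb gb q m) :
  φ ·s φi ≡ sid m -> ψ ·s φ ≡ ψ' ·s φ -> ψ ≡ ψ'.
Proof.
intros H E.
apply (sq_trans (sq_sym (sidr L ψ))), (sq_trans (scomp_eq (sq_refl _) (sq_sym H))).
apply (sq_trans (sq_sym (sassoc L _ _ _))), (sq_trans (scomp_eq E (sq_refl _))).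
apply (sq_trans (sassoc L _ _ _)), (sq_trans (scomp_eq (sq_refl _) H)).
apply (sidr L).
Qed.

(** Naturality is an axiom for [lunit] and passes to its inverse by composing with [lunit n]. *)
Lemma luniti_nat (X Y Z W : Ob D) (f : Arr X Y) (g : Arr Z W) (m : Pro X Z)
    (n : Pro Y W) (φ : Sq f g m n) : luniti m ·s (Us f ⊙s φ) ≡ φ ·s luniti n.
Proof.
apply scomp_mono with (1 := lunitiK L n).
apply (sq_trans (sassoc L _ _ _)).
apply (sq_trans (scomp_eq (sq_refl _) (lunit_nat L _))).
apply (sq_trans (sq_sym (sassoc L _ _ _))).
apply (sq_trans (scomp_eq (lunitK L _) (sq_refl _))).
apply (sq_trans (sidl L _)), sq_sym, (sq_trans (sassoc L _ _ _)).
apply (sq_trans (scomp_eq (sq_refl _) (lunitK L _))), (sidr L).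
Qed.

Section TwistSquare.
Variables (X Y Z W X' Y' Z' W' : Ob D).
Variables (f : Arr X X') (g : Arr Y Y') (h : Arr Z Z') (k : Arr W W').
Variables (u : Pro X X) (v : Pro W W) (eu : u = U X) (ev : v = U W).
Variables (u' : Pro X' X') (v' : Pro W' W') (eu' : u' = U X') (ev' : v' = U W').
Variables (p : Pro X Y) (b : Pro Y W) (a : Pro X Z) (r : Pro Z W).
Variables (p' : Pro X' Y') (b' : Pro Y' W') (a' : Pro X' Z') (r' : Pro Z' W').
Variables (σ : Sq f g p p') (β : Sq g k b b') (α : Sq f h a a') (τ : Sq h k r r').
Variables (υ : Sq f f u u') (ν : Sq k k v v').
Hypotheses (υE : υ ≡ Us f) (νE : ν ≡ Us k).

Lemma twistr_nat :
  ((σ ⊙s β) ⊙s ν) ·s twistr ev' p' b' ≡ twistr ev p b ·s (σ ⊙s β).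
Proof.
unfold twistr; subst v v'; cbn. rewrite (sq_eqE νE).
rewrite !sid_scompp, !dcomp_sidl. apply (runit_nat L).
Qed.

Lemma twistl_nat :
  twistl eu a r ·s ((υ ⊙s α) ⊙s τ) ≡ (α ⊙s τ) ·s twistl eu' a' r'.
Proof.
unfold twistl; subst u u'; cbn. rewrite (sq_eqE υE).
rewrite !sid_scompp, !dcomp_sidr, <- !(interchange L).
apply scompp_eq; [apply luniti_nat|].
apply (sq_trans (sidl L _)), sq_sym, (sidr L).
Qed.

Lemma twist_eq (φ : Disk (p ⊙ b) (a ⊙ r)) :
  twist eu ev φ ≡ twistr ev p b ·s (φ ·s twistl eu a r).
Proof.
unfold twist. rewrite dcompA.
apply (sq_trans (dcomp_eq _ _)), (scomp_eq (sq_refl _) (dcomp_eq _ _)).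
Qed.

End TwistSquare.

(** Naturality of [twistr] and [twistl] brings both sides to the untwisted ones between the same two
    invertible disks, which then cancel. *)
Lemma twist_sq (X Y Z W X' Y' Z' W' : Ob D)
    (f : Arr X X') (g : Arr Y Y') (h : Arr Z Z') (k : Arr W W')
    (u : Pro X X) (v : Pro W W) (eu : u = U X) (ev : v = U W)
    (u' : Pro X' X') (v' : Pro W' W') (eu' : u' = U X') (ev' : v' = U W')
    (p : Pro X Y) (b : Pro Y W) (a : Pro X Z) (r : Pro Z W)
    (p' : Pro X' Y') (b' : Pro Y' W') (a' : Pro X' Z') (r' : Pro Z' W')
    (σ : Sq f g p p') (β : Sq g k b b') (α : Sq f h a a') (τ : Sq h k r r')
    (υ : Sq f f u u') (ν : Sq k k v v')
    (φ : Disk (p ⊙ b) (a ⊙ r)) (φ' : Disk (p' ⊙ b') (a' ⊙ r')) :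
  υ ≡ Us f -> ν ≡ Us k ->
  ((σ ⊙s β) ⊙s ν) ·s twist eu' ev' φ' ≡ twist eu ev φ ·s ((υ ⊙s α) ⊙s τ)
  <-> (σ ⊙s β) ·s φ' ≡ φ ·s (α ⊙s τ).
Proof.
intros Hu Hv.
assert (E1 : ((σ ⊙s β) ⊙s ν) ·s twist eu' ev' φ'
    ≡ twistr ev p b ·s (((σ ⊙s β) ·s φ') ·s twistl eu' a' r')).
{ apply (sq_trans (scomp_eq (sq_refl _) (twist_eq eu' ev' φ'))).
  apply (sq_trans (sq_sym (sassoc L _ _ _))).
  apply (sq_trans (scomp_eq (twistr_nat ev ev' σ β Hv) (sq_refl _))).
  apply (sq_trans (sassoc L _ _ _)), scomp_eq; [apply sq_refl|].
  apply sq_sym, (sassoc L). }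
assert (E2 : twist eu ev φ ·s ((υ ⊙s α) ⊙s τ)
    ≡ twistr ev p b ·s ((φ ·s (α ⊙s τ)) ·s twistl eu' a' r')).
{ apply (sq_trans (scomp_eq (twist_eq eu ev φ) (sq_refl _))).
  apply (sq_trans (sassoc L _ _ _)), scomp_eq; [apply sq_refl|].
  apply (sq_trans (sassoc L _ _ _)), sq_sym, (sq_trans (sassoc L _ _ _)).
  apply scomp_eq; [apply sq_refl|]. apply sq_sym, (twistl_nat eu eu' α τ Hu). }
split; intros E.
- apply (scomp_mono (φi := twistli eu' a' r') (sq_trans (sq_sym (dcomp_eq _ _))
    (eq_ind_r (fun x => x ≡ _) (sq_refl _) (twistlK eu' a' r')))).
  apply (scomp_epi (φi := twistri ev p b) (sq_trans (sq_sym (dcomp_eq _ _))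
    (eq_ind_r (fun x => x ≡ _) (sq_refl _) (twistriK ev p b)))).
  exact (sq_trans (sq_sym E1) (sq_trans E E2)).
- apply (sq_trans E1), (fun e => sq_trans e (sq_sym E2)).
  apply (scomp_eq (sq_refl _)), (scomp_eq E (sq_refl _)).
Qed.

(** The two sources may differ propositionally, as the image of [U X ⊙ m] under a functor does from
    the composite of the images. *)
Lemma disk_inverse_unique (X Y : Ob D) (m m' n : Pro X Y) (em : m = m')
    (fa fb fc fd : Arr X X) (ga gb gc gd : Arr Y Y)
    (φ : Sq fa ga m n) (φ' : Sq fb gb m' n) (ψ : Sq fc gc n m) (ψ' : Sq fd gd n m') :
  φ ≡ φ' -> ψ ·s φ ≡ sid n -> φ' ·s ψ' ≡ sid m' -> ψ ≡ ψ'.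
Proof. destruct em. apply sq_inv_unique. Qed.

Lemma dcomp_eqd_r (X Y : Ob D) (m n p : Pro X Y) (φ : Disk m n) (e : n = p) :
  φ ·d eqd e ≡ φ.
Proof. destruct e; cbn. rewrite dcomp_sidr. apply sq_refl. Qed.

Lemma dcomp_eqd_l (X Y : Ob D) (m n p : Pro X Y) (φ : Disk n p) (e : m = n) :
  eqd e ·d φ ≡ φ.
Proof. destruct e; cbn. rewrite dcomp_sidl. apply sq_refl. Qed.

End Disks.

(** * Coherators of dummy difunctors *)

Section Dummy.
Variables (C D : DoubleCategory) (F : Functor C D).

(** The functor laws mention [lunit]; its inverse is preserved because inverses are unique. *)
Lemma Fs_luniti (X Y : Ob C) (m : Pro X Y) : Fs F (luniti m) ≡ luniti (Fp F m).
Proof.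
pose proof (dc_laws C) as LC. pose proof (dc_laws D) as LD.
assert (e : Fp F (U X ⊙ m) = U (F X) ⊙ Fp F m) by now rewrite Fp_comp, Fp_U.
apply (disk_inverse_unique e (Fs_lunit F m)).
- apply (sq_trans (sq_sym (Fs_comp F _ _))), (sq_trans (Fs_eq F (lunitK LC m))).
  apply Fs_id.
- apply (lunitiK LD).
Qed.

Lemma Fs_dcomp (X Y : Ob C) (m n p : Pro X Y) (φ : Disk m n) (ψ : Disk n p) :
  Fs F (φ ·d ψ) ≡ Fs F φ ·s Fs F ψ.
Proof. exact (sq_trans (Fs_eq F (dcomp_eq φ ψ)) (Fs_comp F φ ψ)). Qed.

(** Only the second component of a coherator survives the projection: a doubled unit here, an
    identity for [bsplitr], and a unit moved from right to left for [bswap]. *)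
Lemma bsplitl_dummy (X Y Z : Ob C) (p : Pro X Y) (q : Pro Y Z) (A : Ob C) :
  bsplitl (dummy_difunctor F) (rp q) (rp p) A ≡ luniti (U (F A)).
Proof.
apply (sq_trans (dcomp_eqd_r _ _)), (sq_trans (retype_eq _ _ _)); cbn.
apply (sq_trans (Fs_luniti _)). rewrite Fp_U. apply sq_refl.
Qed.

Lemma bsplitr_dummy (A : Ob C) (X Y Z : Ob C) (p : Pro X Y) (q : Pro Y Z) :
  bsplitr (dummy_difunctor F) (A : Ob (refl C)) p q ≡ sid (Fp F (p ⊙ q)).
Proof.
apply (sq_trans (dcomp_eqd_r _ _)), (sq_trans (retype_eq _ _ _)); cbn.
apply Fs_id.
Qed.

Lemma bswap_dummy (X Y X' Y' : Ob C) (p : Pro X Y) (q : Pro X' Y') :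
  bswap (dummy_difunctor F) (rp p) q ≡ runit (Fp F q) ·s luniti (Fp F q).
Proof.
unfold bswap. apply (sq_trans (dcomp_eqd_r _ _)), (sq_trans (dcomp_eqd_l _ _)).
apply (sq_trans (retype_eq _ _ _)); cbn. apply (sq_trans (Fs_dcomp _ _)).
apply scomp_eq; [apply Fs_runit|apply Fs_luniti].
Qed.

End Dummy.

(** * Transfer of the laws and the bijection *)

Section Bijection.
Variables (C D : DoubleCategory) (F G : Functor C D).

Lemma is_dinatural_dummy (α : NatData F G) :
  is_dinatural (dummy_data α) <-> is_natural α.
Proof.
(* Both sides are read off from [twist_comp]; unfolding the dummy constructions identifies them with
   the two composition laws. *)
assert (HP : forall (A B E : Ob C) (m : Pro A B) (n : Pro B E), _ <-> _) by
  (intros A B E m n;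
   exact (twist_comp (Fp_U F A) (Fp_U F B) (Fp_U G B) (Fp_U G E)
     (Fp_comp F m n) (Fp_comp G m n) (natP α m) (natP α n) (natP α (m ⊙ n))
     (bsplitl_dummy F m n A) (bsplitl_dummy G m n E)
     (bsplitr_dummy F E m n) (bsplitr_dummy G A m n)
     (bswap_dummy F n m) (bswap_dummy G m n))).
assert (HS : forall (X Y Z W : Ob C) (f : Arr X Y) (g : Arr Z W) (m : Pro X Z)
    (n : Pro Y W) (φ : Sq f g m n), _ <-> _) by
  (intros X Y Z W f g m n φ;
   exact (twist_sq (Fp_U F X) (Fp_U G Z) (Fp_U F Y) (Fp_U G W)
     (Fs F φ) (natA α g) (natA α f) (Fs G φ) (natP α m) (natP α n)
     (Fs_Us F f) (Fs_Us G g))).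
split; intros H; constructor.
- intros A B m. apply (invertible_twist (Fp_U F A) (Fp_U G B)), (dinP_inv H m).
- exact (dinA_id H).
- exact (dinA_comp H).
- intros A. eapply twist_unit, (dinP_U H A).
- intros A B E m n. apply HP, (dinP_comp H m n).
- intros X Y Z W f g m n φ. apply HS, (dinat_sq H φ).
- intros A B m. apply invertible_twist, (natP_inv H m).
- exact (natA_id H).
- exact (natA_comp H).
- intros A. apply twist_unit, (natP_U H A).
- intros A B E m n. apply HP, (natP_comp H m n).
- intros X Y Z W f g m n φ. apply HS, (nat_sq H φ).
Qed.

Definition undummy_data
    (β : DinatData (dummy_difunctor F) (dummy_difunctor G)) : NatData F G :=
  @Build_NatData C D F G (dinO β) (fun A B f => dinA β f)
    (fun A B m => untwist (Fp_U F A) (Fp_U G B) (dinP β m)).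

Lemma dummy_dataK (α : NatData F G) : undummy_data (dummy_data α) = α.
Proof.
destruct α as [αO αA αP]. unfold undummy_data; cbn. f_equal.
extensionality A; extensionality B; extensionality m. apply twistK.
Qed.

Lemma undummy_dataK (β : DinatData (dummy_difunctor F) (dummy_difunctor G)) :
  dummy_data (undummy_data β) = β.
Proof.
destruct β as [βO βA βP]. unfold dummy_data; cbn. f_equal.
extensionality A; extensionality B; extensionality m. apply untwistK.
Qed.

Lemma NatTrans_eq (α α' : NatTrans F G) : nat_data α = nat_data α' -> α = α'.
Proof.
destruct α as [a H], α' as [a' H']; cbn; intros <-. f_equal. apply proof_irrelevance.
Qed.

End Bijection.

Lemma DinatTrans_eq (C D : DoubleCategory) (F G : Difunctor C D)
    (β β' : DinatTrans F G) : dinat_data β = dinat_data β' -> β = β'.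
Proof.
destruct β as [b H], β' as [b' H']; cbn; intros <-. f_equal. apply proof_irrelevance.
Qed.

Theorem proposition3p8 (C D : DoubleCategory) (F G : Functor C D) :
  exists Φ : NatTrans F G -> DinatTrans (dummy_difunctor F) (dummy_difunctor G),
    (forall α : NatTrans F G, dinat_data (Φ α) = dummy_data (nat_data α))
    /\ Bijective Φ.
Proof.
exists (fun α : NatTrans F G => Build_DinatTrans (proj2 (is_dinatural_dummy (nat_data α)) (nat_laws α))).
split; [reflexivity|].
(* The untwisted data are natural because their dummy is [β] itself, and the equivalence of laws
   also runs from dinatural to natural. *)
assert (N : forall β : DinatTrans (dummy_difunctor F) (dummy_difunctor G),
    is_natural (undummy_data β)).
{ intros β. apply is_dinatural_dummy. rewrite undummy_dataK. apply dinat_laws. }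
exists (fun β : DinatTrans _ _ => Build_NatTrans (N β)). split.
- intros α. apply NatTrans_eq, dummy_dataK.
- intros β. apply DinatTrans_eq, undummy_dataK.
Qed.
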